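(* Let $c\ge2$ be an integer. When all agents in $N$ have $\{1,c\}$-SUB valuations, every leximin allocation $X$ is $\frac1{c+2}$-MMS, i.e. $v_i(X_i)\ge\frac1{c+2}\,\mathrm{MMS}_i$ for all $i\in N$.
   Context: $N=\{1,\dots,n\}$ is a set of agents and $G$ a finite set of goods; agent $i$ has valuation $v_i:2^G\to\mathbb{R}_{\ge0}$. A valuation $v$ is $\{1,c\}$-SUB if $v(\emptyset)=0$; every marginal gain $v(S\cup\{g\})-v(S)$ with $S\subseteq G$, $g\in G\setminus S$ lies in $\{1,c\}$; and $v(S\cup\{g\})-v(S)\ge v(T\cup\{g\})-v(T)$ for all $S\subseteq T\subseteq G$, $g\in G\setminus T$. An allocation $X=(X_0,X_1,\dots,X_n)$ is a partition of $G$ into $n+1$ (possibly empty) bundles; $X_i$ goes to agent $i\in N$ and $X_0$ is the set of unallocated goods. The sorted utility vector $\vec s^X$ is $(v_1(X_1),\dots,v_n(X_n))$ sorted in ascending order. $X$ is leximin if there is no allocation $Y$ and index $k\in[n]$ with $s^Y_j=s^X_j$ for all $j<k$ and $s^Y_k>s^X_k$. The maximin share of agent $i$ is $\mathrm{MMS}_i=\max_X\min_{j\in N}v_i(X_j)$, the maximum being over all allocations $X$. *)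

(* Defs.v *)
From mathcomp Require Import all_boot all_order all_algebra.

Set Implicit Arguments.
Unset Strict Implicit.
Unset Printing Implicit Defensive.

Import Order.TTheory GRing.Theory Num.Theory.
Local Open Scope ring_scope.

Section FairDivision.
Variables (R : realFieldType) (G : finType) (n : nat).

Definition valuation (v : {set G} -> R) : Prop := forall S, 0 <= v S.

Definition marginal (v : {set G} -> R) (S : {set G}) (g : G) : R :=
  v (g |: S) - v S.

Definition one_c_SUB (c : R) (v : {set G} -> R) : Prop :=
  [/\ v set0 = 0,
      forall (S : {set G}) (g : G), g \notin S ->
        marginal v S g = 1 \/ marginal v S g = c
    & forall (S T : {set G}) (g : G), S \subset T -> g \notin T ->
        marginal v T g <= marginal v S g].

(* An ordered partition (X_0, X_1, ..., X_n) of the goods into possibly empty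
   bundles, given by the map sending each good to the index of its bundle:
   [None] is the index of X_0 (unallocated) and [Some i] that of agent i. *)
Definition allocation := {ffun G -> option 'I_n}.

Definition bundle (X : allocation) (a : option 'I_n) : {set G} :=
  [set g | X g == a].

Definition utility (v : 'I_n -> {set G} -> R) (X : allocation) (i : 'I_n) : R :=
  v i (bundle X (Some i)).

Definition sorted_utilities (v : 'I_n -> {set G} -> R) (X : allocation)
    : seq R :=
  sort <=%R [seq utility v X i | i <- enum 'I_n].

Definition leximin (v : 'I_n -> {set G} -> R) (X : allocation) : Prop :=
  ~ exists (Y : allocation) (k : 'I_n),
      (forall j : 'I_n, (j < k)%N ->
         (sorted_utilities v Y)`_j = (sorted_utilities v X)`_j)
      /\ (sorted_utilities v X)`_k < (sorted_utilities v Y)`_k.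

(* The default value of the big minimum is one of its terms, so this is the
   minimum over all agents j of v_i(X_j). *)
Definition min_share (v : 'I_n -> {set G} -> R) (i : 'I_n) (X : allocation)
    : R :=
  \big[Num.min/v i (bundle X (Some i))]_(j < n) v i (bundle X (Some j)).

(* The default value is the term of the allocation with X_0 = G, so this is the
   maximum over all allocations. *)
Definition MMS (v : 'I_n -> {set G} -> R) (i : 'I_n) : R :=
  \big[Num.max/min_share v i [ffun=> None]]_(X : allocation) min_share v i X.

End FairDivision.

(* Main.v *)
(* Moving a single good to agent i cannot improve a leximin allocation X, so
   every good is allocated and every other agent j, once deprived of one of its
   goods, has utility at most u = v_i(X_i). As each good is worth at least 1,
   |X_j| <= u + 1 and |X_i| <= u, whence |G| < n (u + 1). In any allocation
   some agent then gets at most u goods (u is an integer), which are worth at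
   most c u to agent i. This gives even MMS_i <= c u. *)
Require Import Defs.
From mathcomp Require Import all_boot all_order all_algebra.
From mathcomp Require Import zify.

Set Implicit Arguments.
Unset Strict Implicit.
Unset Printing Implicit Defensive.

Import Order.TTheory GRing.Theory Num.Theory.
Local Open Scope ring_scope.

(** Both sides are sorted permutations of [s]: the threshold [u] separates [A] from [B]. *)
Lemma sort_cat_le (R : realFieldType) (s A B : seq R) (u : R) :
    perm_eq s (A ++ B) -> all (<= u) A -> all (>= u) B ->
  sort <=%R s = sort <=%R A ++ sort <=%R B.
Proof.
move=> sAB /allP leAu /allP leuB.
apply: (sorted_eq le_trans le_anti); first exact: sort_le_sorted.
  rewrite sorted_pairwise ?pairwise_cat; last exact: le_trans.
  rewrite -!sorted_pairwise ?sort_le_sorted ?andbT; try exact: le_trans.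
  apply/allrelP => x y; rewrite !mem_sort => /leAu xu /leuB; exact: le_trans.
by rewrite perm_sort (perm_trans sAB) // perm_cat // perm_sym perm_sort.
Qed.

(** Let [A] collect the values [f j <= f i] with [j != i]. They survive in [h], while every other
    value of [h] exceeds [f i]. So both sorted sequences begin with sorted [A], and the next entry
    is [f i] for [f] but larger for [h]. *)
Lemma sort_map_lexi_lt (R : realFieldType) (n : nat) (f h : 'I_n -> R)
    (i : 'I_n) :
    f i < h i ->
    (forall j, j != i -> h j = f j \/ f i < f j /\ f i < h j) ->
  exists k : 'I_n,
    (forall j : 'I_n, (j < k)%N ->
       (sort <=%R [seq h x | x <- enum 'I_n])`_j =
       (sort <=%R [seq f x | x <- enum 'I_n])`_j)
    /\ (sort <=%R [seq f x | x <- enum 'I_n])`_k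
       < (sort <=%R [seq h x | x <- enum 'I_n])`_k.
Proof.
move=> fhi fhj.
pose e := rem i (enum 'I_n); pose P j := f j <= f i.
pose A := [seq f j | j <- e & P j]; pose e' := [seq j <- e | predC P j].
have e_neq j : j \in e -> j != i.
  by rewrite mem_rem_uniq ?enum_uniq // => /andP[].
(* Where [f j <= f i], the second alternative of [fhj] is impossible, so [h] and [f] agree. *)
have hA : [seq h j | j <- e & P j] = A.
  apply/eq_in_map => j; rewrite mem_filter => /andP[Pj /e_neq /fhj[]//].
  by case=> lt_ij _; move: Pj; rewrite /P leNgt lt_ij.
have enumE : perm_eq (enum 'I_n) ([seq j <- e | P j] ++ i :: e').
  rewrite (perm_trans (perm_to_rem (mem_enum 'I_n i))) //.
  by rewrite perm_sym perm_catC /= perm_cons perm_catC perm_filterC.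
have mapE (k : 'I_n -> R) : perm_eq [seq k x | x <- enum 'I_n]
    ([seq k j | j <- e & P j] ++ k i :: [seq k j | j <- e']).
  by rewrite -map_cons -map_cat; apply: perm_map.
have leA : all (<= f i) A.
  by apply/allP => _ /mapP[j + ->]; rewrite mem_filter => /andP[].
have ltB : {in e', forall j, f i < f j /\ f i < h j}.
  move=> j; rewrite mem_filter /= /P -ltNge => /andP[lt_ij /e_neq /fhj].
  by case=> [->|].
have lef : all (>= f i) [seq f j | j <- e'].
  by apply/allP => _ /mapP[j /ltB[/ltW ? _] ->].
have lth : all (> f i) (h i :: [seq h j | j <- e']).
  by apply/allP => _ /[1!inE] /orP[/eqP->//|/mapP[j /ltB[_ ?] ->]].
have sf : sort <=%R [seq f x | x <- enum 'I_n]
    = sort <=%R A ++ sort <=%R [:: f i] ++ sort <=%R [seq f j | j <- e'].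
  rewrite (sort_cat_le (mapE f) leA) /= ?lexx //; congr (_ ++ _).
  by apply: (@sort_cat_le _ _ [:: f i] _ (f i)) => //=; rewrite lexx.
have sh : sort <=%R [seq h x | x <- enum 'I_n]
    = sort <=%R A ++ sort <=%R (h i :: [seq h j | j <- e']).
  rewrite -hA; apply: (sort_cat_le (u := f i) (mapE h)); first by rewrite hA.
  by apply: sub_all lth => x /ltW.
(* The first difference occurs at position [size A], a valid index because [A] omits the entry of
   [i]. *)
have ltAn : (size A < n)%N.
  have := perm_size enumE; rewrite size_enum_ord size_cat /= /A size_map => nE.
  by rewrite [ltnRHS]nE addnS ltnS leq_addr.
exists (Ordinal ltAn); rewrite sf sh; split=> [j /= ltjA|/=].
  by rewrite !nth_cat size_sort ltjA.
rewrite !nth_cat size_sort ltnn subnn /=.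
by apply: (allP lth); rewrite -(mem_sort <=%R) mem_nth // size_sort.
Qed.

Section OneCValuation.
Variables (R : realFieldType) (G : finType) (c : nat) (v : {set G} -> R).
Hypotheses (c_gt0 : (0 < c)%N) (v_sub : one_c_SUB c%:R v).

Lemma one_c_SUB_ltU1 (S : {set G}) (g : G) : g \notin S -> v S < v (g |: S).
Proof.
case: v_sub => _ marg _ /marg; rewrite /marginal => marg1.
rewrite -subr_gt0; case: marg1 => ->; by rewrite ?ltr01 ?ltr0n.
Qed.

(** Build [S] one good at a time: each marginal gain is 1 or [c], hence a natural number between 1
    and [c]. *)
Lemma one_c_SUB_natE (S : {set G}) :
  exists2 m, v S = m%:R & (#|S| <= m <= c * #|S|)%N.
Proof.
have [m leSm] := ubnP #|S|; elim: m => // m IHm in S leSm *.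
have [->|[g gS]] := set_0Vmem S.
  by exists 0%N; [case: v_sub | rewrite cards0].
have cS := cardsD1 g S; rewrite gS in cS.
case: (IHm (S :\ g)) => [|k vk lek]; first by move: leSm; rewrite cS.
have gS' : g \notin S :\ g by rewrite !inE eqxx.
case: v_sub => _ /(_ _ _ gS') + _; rewrite /marginal setD1K // vk.
case=> vS; [exists (k + 1)%N | exists (k + c)%N].
- by apply/eqP; rewrite addnC natrD -subr_eq vS.
- nia.
- by apply/eqP; rewrite addnC natrD -subr_eq vS.
- nia.
Qed.

End OneCValuation.

Section Allocation.
Variables (R : realFieldType) (G : finType) (n : nat).
Implicit Types (X : allocation G n) (v : 'I_n -> {set G} -> R).

Lemma sum_card_bundle X :
  (#|bundle X None| + \sum_(j < n) #|bundle X (Some j)| = #|G|)%N.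
Proof.
rewrite -[RHS]sum1_card (partition_big X predT) //= (bigD1 None) //=.
congr (_ + _)%N; first by rewrite -sum1_card; apply: eq_bigl => g; rewrite inE.
rewrite [RHS](reindex_omap Some id) /=; last by case.
apply: eq_big => [j|j _]; first by rewrite eqxx.
by rewrite -sum1_card; apply: eq_bigl => g; rewrite inE.
Qed.

Definition give X (i : 'I_n) (g : G) : allocation G n :=
  [ffun x => if x == g then Some i else X x].

Lemma bundle_give X i g : bundle (give X i g) (Some i) = g |: bundle X (Some i).
Proof.
by apply/setP => x; rewrite !inE ffunE; case: (x =P g); rewrite ?eqxx.
Qed.

Lemma bundle_give_neq X i g j :
  j != i -> bundle (give X i g) (Some j) = bundle X (Some j) :\ g.
Proof.
move=> ji; apply/setP => x; rewrite !inE ffunE; case: (x =P g) => //= _.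
by apply/eqP => -[ij]; rewrite ij eqxx in ji.
Qed.

Lemma min_share_le X v i j : min_share v i X <= v i (bundle X (Some j)).
Proof. by rewrite /min_share (bigD1 j) //= ge_min lexx. Qed.

Lemma MMS_le v i m : (forall X, min_share v i X <= m) -> MMS v i <= m.
Proof.
(* The default value is itself a minimum share, so the hypothesis bounds it too. *)
move=> le_m; apply: (big_ind (fun x => x <= m)) => // x y.
by rewrite ge_max => -> ->.
Qed.

End Allocation.

Section Leximin.
Variables (R : realFieldType) (G : finType) (n c : nat).
Variables (v : 'I_n -> {set G} -> R) (X : allocation G n) (i : 'I_n).
Hypotheses (c_gt0 : (0 < c)%N) (v_sub : forall j, one_c_SUB c%:R (v j)).
Hypothesis lexX : leximin v X.

(** Otherwise giving [g] to [i] would raise the utility of [i] and could lower only that of a holder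
    who stays above the old utility of [i]. By [sort_map_lexi_lt], this contradicts leximin. *)
Lemma leximin_give (g : G) : X g != Some i ->
  exists2 j, X g = Some j
    & v j (bundle X (Some j) :\ g) <= v i (bundle X (Some i)).
Proof.
move=> Xgi; have gi : g \notin bundle X (Some i) by rewrite inE.
have lti : utility v X i < utility v (give X i g) i.
  by rewrite /utility bundle_give (one_c_SUB_ltU1 c_gt0).
have [/existsP[j /andP[/eqP]]|/existsPn noj] :=
    boolP [exists j, (X g == Some j) &&
      (v j (bundle X (Some j) :\ g) <= v i (bundle X (Some i)))].
  by exists j.
case: lexX; exists (give X i g); apply: sort_map_lexi_lt lti _ => j ji.
rewrite /utility bundle_give_neq //.
have [Xgj|Xgj] := eqVneq (X g) (Some j); last first.
  by left; congr (v j _); apply/setDidPl; rewrite disjoint_sym disjoints1 inE.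
(* The holder is above [i] after losing [g], hence also before, by strict monotonicity. *)
right; have := noj j; rewrite Xgj eqxx /= -ltNge => ltij.
split=> //; apply: lt_trans ltij _.
have gj : g \in bundle X (Some j) by rewrite inE Xgj.
by rewrite -{2}(setD1K gj) (one_c_SUB_ltU1 c_gt0) // !inE eqxx.
Qed.

Lemma leximin_card_lt (m : nat) :
  v i (bundle X (Some i)) = m%:R -> (#|G| < n * m.+1)%N.
Proof.
(* An unallocated good would have a holder by [leximin_give]. *)
move=> vm; have X0 : bundle X None = set0.
  apply/setP => g; rewrite !inE; apply/negP => /eqP Xg.
  by case: (@leximin_give g) => [|j]; rewrite Xg.
have cardi : (#|bundle X (Some i)| <= m)%N.
  have [k] := one_c_SUB_natE c_gt0 (v_sub i) (bundle X (Some i)).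
  by rewrite vm => /eqP; rewrite eqr_nat => /eqP-> /andP[].
have cardj j : j != i -> (#|bundle X (Some j)| <= m.+1)%N.
  move=> ji; have [->|[g gj]] := set_0Vmem (bundle X (Some j)).
    by rewrite cards0.
  have Xg : X g = Some j by move: gj; rewrite inE => /eqP.
  case: (@leximin_give g) => [|j' + ].
    by rewrite Xg; apply/eqP => -[/eqP]; apply/negP.
  rewrite Xg => -[<-]; rewrite vm.
  have [k -> /andP[lek _]] :=
    one_c_SUB_natE c_gt0 (v_sub j) (bundle X (Some j) :\ g).
  by rewrite ler_nat (cardsD1 g) gj ltnS; apply: leq_trans.
rewrite -(sum_card_bundle X) X0 cards0 add0n.
rewrite -[n in (n * _)%N]card_ord -sum_nat_const (bigD1 i) //=.
rewrite [ltnRHS](bigD1 i) //=.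
(* The inequality is strict because [i] holds at most [m] goods, not [m.+1]. *)
by rewrite -addSn leq_add // leq_sum.
Qed.

End Leximin.

Theorem theorem7p2 (R : realFieldType) (G : finType) (n c : nat)
    (hc : (2 <= c)%N)
    (v : 'I_n -> {set G} -> R)
    (hv : forall i : 'I_n, valuation (v i))
    (hsub : forall i : 'I_n, one_c_SUB c%:R (v i))
    (X : allocation G n) (hX : leximin v X) (i : 'I_n) :
  1 / (c%:R + 2) * MMS v i <= utility v X i.
Proof.
have c_gt0 : (0 < c)%N by apply: ltnW.
have [m vm _] := one_c_SUB_natE c_gt0 (hsub i) (bundle X (Some i)).
have ltG := leximin_card_lt c_gt0 hsub hX vm.
have leMMS : MMS v i <= (c * m)%:R.
  apply: MMS_le => Z.
  (* Pigeonhole: if all [n] bundles had at least [m.+1] goods, [ltG] would fail. *)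
  have [/existsP[j lejm]|/existsPn gtm] :=
      boolP [exists j, #|bundle Z (Some j)| <= m]%N.
    apply: le_trans (min_share_le Z v i j) _.
    have [k -> /andP[_ lek]] :=
      one_c_SUB_natE c_gt0 (hsub i) (bundle Z (Some j)).
    by rewrite ler_nat (leq_trans lek) // leq_mul2l lejm orbT.
  move: ltG; rewrite ltnNge -(sum_card_bundle Z) => /negP[].
  apply: leq_trans (leq_addl _ _).
  rewrite -[n in (n * _)%N]card_ord -sum_nat_const.
  by apply: leq_sum => j _; rewrite ltnNge.
rewrite /utility vm mulrAC mul1r ler_pdivrMr; last first.
  by rewrite -natrD ltr0n addn2.
apply: le_trans leMMS _.
by rewrite -natrD -natrM ler_nat mulnC leq_mul2l leq_addr orbT.
Qed.
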